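(* A topological space $(X,T)$ is sober if and only if for every nonempty closed set $A\subseteq X$ such that ${}^*A$ is downward directed, ${}^*A$ has a smallest element belonging to $A$; that is, there is $x\in A$ with $x\le\alpha$ for all $\alpha\in{}^*A$.
   Context: Nonstandard setting. Let $S\supseteq X\cup\mathbb R$ be a set of individuals, with superstructure $V(S)=\bigcup_{k\ge 0}V_k(S)$, $V_0(S)=S$, $V_{k+1}(S)=V_k(S)\cup\mathcal P(V_k(S))$. A $\kappa$-saturated nonstandard model of $S$ is a superstructure $V({}^*S)$ with a map $A\mapsto {}^*A$ from $V(S)$ into $V({}^*S)$ satisfying: (Extension) ${}^*s=s$ for all $s\in S$; (Transfer) a bounded quantifier formula $\Phi(A_1,\dots,A_n)$ with constants in $V(S)$ is true iff $\Phi({}^*A_1,\dots,{}^*A_n)$ is true in $V({}^*S)$; (Saturation) every family of at most $\kappa$ internal sets with the finite intersection property has nonempty intersection. An entity of $V({}^*S)$ is internal if it is an element of ${}^*A$ for some $A\in V(S)$. Throughout, a $\kappa$-saturated model with $\kappa$ infinite and $\kappa>\operatorname{card}T$ is fixed; $X\subseteq {}^*X$. Monads: for $\alpha\in{}^*X$, $\mu(\alpha)=\bigcap\{{}^*G:G\in T,\ \alpha\in{}^*G\}$. For $\alpha,\beta\in{}^*X$ write $\alpha\le\beta$ if $\mu(\alpha)\subseteq\mu(\beta)$. A set $D\subseteq{}^*X$ is downward directed if for any $\alpha,\beta\in D$ there is $\gamma\in D$ with $\gamma\le\alpha$ and $\gamma\le\beta$. A nonempty closed $A\subseteq X$ is irreducible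 if for any closed $F_1,F_2\subseteq X$, $A=F_1\cup F_2$ implies $A=F_1$ or $A=F_2$. The space $(X,T)$ is sober if every irreducible closed subset $A$ of $X$ is of the form $A=\mathrm{cl}_X\{x\}$ for some $x\in X$ (uniqueness of $x$ is not required). *)

(* Defs.v *)
From mathcomp Require Import all_boot all_order all_algebra.
From mathcomp Require Import all_classical all_reals topology.

Set Implicit Arguments.
Unset Strict Implicit.
Unset Printing Implicit Defensive.

Local Open Scope classical_set_scope.
Local Open Scope card_scope.

(* Individuals are atoms, so every element of V_(k+1)(S) that is not an
   individual is a subset of V_k(S): V_(k+1)(S) is the disjoint union of S and
   the power set of V_k(S). *)
Fixpoint level (S : Type) (k : nat) : Type :=
  if k is k'.+1 then (S + set (level S k'))%type else S.

(* The levels are cumulative in the superstructure but disjoint as types, so an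
   entity has one representative in each sufficiently high level; [same_level]
   tells whether x and y represent the same entity (the same individual, or
   sets with the same elements). *)
Fixpoint same_level (S : Type) (k l : nat) :
    level S k -> level S l -> Prop :=
  match k, l return level S k -> level S l -> Prop with
  | 0, 0 => fun s t => s = t
  | 0, _.+1 => fun s y => y = inl s
  | _.+1, 0 => fun x t => x = inl t
  | k'.+1, l'.+1 => fun x y =>
      match x, y with
      | inl s, inl t => s = t
      | inr A, inr B =>
          (forall a, A a -> exists2 b, B b & same_level a b) /\
          (forall b, B b -> exists2 a, A a & same_level a b)
      | _, _ => False
      end
  end.

Definition superstructure (S : Type) : Type := {k : nat & level S k}.

Definition same (S : Type) (x y : superstructure S) : Prop :=
  same_level (projT2 x) (projT2 y).

Definition level_elements (S : Type) (k : nat) :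
    level S k -> set (superstructure S) :=
  match k return level S k -> set (superstructure S) with
  | 0 => fun _ => set0
  | k'.+1 => fun y =>
      if y is inr B
      then [set x | exists2 b : level S k', B b & same x (existT _ k' b)]
      else set0
  end.

Definition elements (S : Type) (y : superstructure S) :
    set (superstructure S) := level_elements (projT2 y).

Definition belongs (S : Type) (x y : superstructure S) : Prop :=
  elements y x.

Definition individual (S : Type) (s : S) : superstructure S :=
  existT (level S) 0 s.

Definition set_entity (S : Type) (A : set S) : superstructure S :=
  existT (level S) 1 (inr A).

Definition is_set (S : Type) (x : superstructure S) : Prop :=
  forall s : S, ~ same x (individual s).

(* First-order formulas in the language of membership and equality in which
   all quantifiers are bounded.  Variables are natural numbers; constants are
   the values that an assignment gives to the free variables.  [FForall x y p]
   is "for all x in y, p". *)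
Inductive bounded_formula : Type :=
  | FMem of nat & nat
  | FEq of nat & nat
  | FNot of bounded_formula
  | FAnd of bounded_formula & bounded_formula
  | FOr of bounded_formula & bounded_formula
  | FImplies of bounded_formula & bounded_formula
  | FForall of nat & nat & bounded_formula
  | FExists of nat & nat & bounded_formula.

Definition assign (V : Type) (e : nat -> V) (x : nat) (a : V) : nat -> V :=
  fun i => if i == x then a else e i.

Fixpoint holds (S : Type) (e : nat -> superstructure S)
    (p : bounded_formula) : Prop :=
  match p with
  | FMem x y => belongs (e x) (e y)
  | FEq x y => same (e x) (e y)
  | FNot q => ~ holds e q
  | FAnd q r => holds e q /\ holds e r
  | FOr q r => holds e q \/ holds e r
  | FImplies q r => holds e q -> holds e r
  | FForall x y q => forall a, belongs a (e y) -> holds (assign e x a) q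
  | FExists x y q => exists2 a, belongs a (e y) & holds (assign e x a) q
  end.

Definition internal (S S' : Type) (star : superstructure S -> superstructure S')
    (x : superstructure S') : Prop :=
  exists A, belongs x (star A).

Definition saturated (S S' K : Type)
    (star : superstructure S -> superstructure S') : Prop :=
  forall (I : Type) (F : I -> superstructure S'),
    [set: I] #<= [set: K] ->
    (forall i, is_set (F i) /\ internal star (F i)) ->
    (forall J : set I, finite_set J -> \bigcap_(i in J) elements (F i) !=set0) ->
    \bigcap_i elements (F i) !=set0.

(* The cardinal kappa is the cardinality of the type K.  [star_ground] says
   that the individuals of the nonstandard superstructure are exactly the
   elements of the star image of the set S.  [std] is the inclusion of S into
   them; its injectivity is a consequence of [extension] and [transfer]. *)
Record saturated_model (S K : Type) := SaturatedModel {
  star_individuals : Type;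
  std : S -> star_individuals;
  star : superstructure S -> superstructure star_individuals;
  star_ground : same (star (set_entity [set: S]))
                     (set_entity [set: star_individuals]);
  extension : forall s : S, same (star (individual s)) (individual (std s));
  transfer : forall (p : bounded_formula) (e : nat -> superstructure S),
    holds e p <-> holds (star \o e) p;
  saturation : saturated K star
}.

Section Monads.

Variables (X : topologicalType) (S K : Type) (iX : X -> S).
Variable M : saturated_model S K.

Let V' := superstructure (star_individuals M).

Definition star_set (A : set X) : set V' :=
  elements (star M (set_entity (iX @` A))).

Definition star_point (x : X) : V' := individual (std M (iX x)).

Definition monad (a : V') : set V' :=
  \bigcap_(G in [set G : set X | open G /\ star_set G a]) star_set G.

Definition monad_le (a b : V') : Prop := monad a `<=` monad b.

Definition downward_directed (D : set V') : Prop :=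
  forall a b, D a -> D b -> exists c, [/\ D c, monad_le c a & monad_le c b].

End Monads.

Arguments star_set {X S K} iX M A _.
Arguments star_point {X S K} iX M x.

Definition irreducible_closed (X : topologicalType) (A : set X) : Prop :=
  [/\ A !=set0, closed A &
    forall F1 F2 : set X, closed F1 -> closed F2 ->
      A = F1 `|` F2 -> A = F1 \/ A = F2].

Definition sober (X : topologicalType) : Prop :=
  forall A : set X, irreducible_closed A ->
    exists x : X, A = closure [set x].

(* Main.v *)
(** A closed set A is irreducible iff *A is downward directed.  If A is
    irreducible, then for a, b in *A the internal sets *(A `&` G), with G open
    and a or b in *G, have the finite intersection property, and saturation
    gives a common lower bound of a and b.  Conversely, if A is the union of
    proper closed subsets F1 and F2, a lower bound in *A of a point outside F1
    and a point outside F2 would lie in the star of the empty set A \ (F1 `|` F2).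
    Moreover x in A is least in *A iff A is the closure of x. *)
Require Import Defs.
From mathcomp Require Import all_boot all_order all_algebra.
From mathcomp Require Import all_classical all_reals topology.

Local Open Scope classical_set_scope.
Local Open Scope card_scope.

(** * Entities of the superstructure up to [same] *)

Lemma same_level_refl (S : Type) (k : nat) (x : level S k) : same_level x x.
Proof.
elim: k x => [|k IH] //= [s|A] //=.
by split=> a Aa; exists a.
Qed.

Lemma same_level_sym (S : Type) (k l : nat) (x : level S k) (y : level S l) :
  same_level x y -> same_level y x.
Proof.
elim: k l x y => [|k IH] [|l] //= [s|A] [t|B] //= [AB BA].
split=> [b /BA[a Aa ab]|a /AB[b Bb ab]]; [exists a|exists b] => //; exact: IH.
Qed.

Lemma same_level_trans (S : Type) (k l m : nat)
    (x : level S k) (y : level S l) (z : level S m) :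
  same_level x y -> same_level y z -> same_level x z.
Proof.
elim: k l m x y z => [|k IH] [|l] [|m] //=.
- by move=> x y z -> ->.
- by move=> x y z -> ->.
- by move=> x y z -> [].
- by move=> x [t|B] [u|C] //= [->] // ->.
- by move=> x y z -> ->.
- by move=> [s|A] y [u|C] //= [->] // [->].
- by move=> [s|A] [t|B] z //= -> // [->].
move=> [s|A] [t|B] [u|C] //=; first by move=> -> ->.
move=> [AB BA] [BC CB]; split.
  by move=> a /AB[b /BC[c Cc bc] ab]; exists c => //; exact: IH bc.
by move=> c /CB[b /BA[a Aa ab] bc]; exists a => //; exact: IH bc.
Qed.

Lemma same_refl (S : Type) (x : superstructure S) : same x x.
Proof. exact: same_level_refl. Qed.

Lemma same_sym (S : Type) (x y : superstructure S) : same x y -> same y x.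
Proof. exact: same_level_sym. Qed.

Lemma same_trans (S : Type) (x y z : superstructure S) :
  same x y -> same y z -> same x z.
Proof. exact: same_level_trans. Qed.

Lemma belongs_same (S : Type) (x x' y : superstructure S) :
  same x x' -> belongs x y -> belongs x' y.
Proof.
move=> xx'; case: y => [[|k]] //= [s|B] //= [b Bb xb].
by exists b => //; apply: same_trans xb; exact: same_sym.
Qed.

Lemma belongs_is_set (S : Type) (x y : superstructure S) :
  belongs x y -> is_set y.
Proof. by case: y => [[|k]] //= [s|B]. Qed.

Lemma same_individual (S : Type) (s t : S) :
  same (individual s) (individual t) -> s = t.
Proof. by []. Qed.

Lemma belongs_set_entity (S : Type) (A : set S) (x : superstructure S) :
  belongs x (set_entity A) <-> exists2 s, A s & same x (individual s).
Proof. by []. Qed.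

Lemma belongs_individual (S : Type) (A : set S) (s : S) :
  belongs (individual s) (set_entity A) <-> A s.
Proof.
split=> [/belongs_set_entity[t At st]|As].
  by rewrite (same_individual _ _ _ st).
by apply/belongs_set_entity; exists s => //; exact: same_refl.
Qed.

(** * Instances of transfer for single bounded formulas *)

Section SaturatedModel.
Context {S K : Type} (M : saturated_model S K).

Lemma star_belongs (x y : superstructure S) :
  belongs x y <-> belongs (star M x) (star M y).
Proof.
exact: (transfer M (FMem 0 1) (fun i => if i is 0 then x else y)).
Qed.

Lemma star_internal (x : superstructure S) : internal (star M) (star M x).
Proof.
(* The witness is the singleton of [x], one level up: transfer turns membership in it into
   membership in its star. *)
case: x => k x; exists (existT (level S) k.+1 (inr [set x])).
by apply: (star_belongs _ _).1; exists x => //; exact: same_refl.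
Qed.

Lemma star_elements_nonempty (x : superstructure S) :
  elements x !=set0 <-> elements (star M x) !=set0.
Proof.
(* The trivially true [FEq 0 0] serves as the body of a bounded existential that says only that [x]
   has an element. *)
have [h1 h2] := transfer M (FExists 0 1 (FEq 0 0)) (fun=> x).
split=> -[a xa].
  by have [|b yb _] := h1; [exists a => //; exact: same_refl | exists b].
by have [|b yb _] := h2; [exists a => //; exact: same_refl | exists b].
Qed.

Lemma star_elements_setI (x y z : superstructure S) :
  elements x `&` elements y `<=` elements z ->
  elements (star M x) `&` elements (star M y) `<=` elements (star M z).
Proof.
move=> xyz a [xa ya].
have [h _] := transfer M (FForall 0 1 (FImplies (FMem 0 2) (FMem 0 3)))
  (fun i => match i with 1 => x | 2 => y | _ => z end).
by apply: h xa ya => b xb yb; exact: xyz.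
Qed.

End SaturatedModel.

(** * Stars of subsets of X, monads and irreducible closed sets *)

Section StarSet.
Context {X : topologicalType} {S K : Type} {iX : X -> S}.
Hypothesis iX_inj : injective iX.
Variable M : saturated_model S K.

Lemma star_pointP (A : set X) (x : X) :
  star_set iX M A (star_point iX M x) <-> A x.
Proof.
have E := extension M (iX x).
split=> [xA|Ax].
  have : belongs (star M (individual (iX x))) (star M (set_entity (iX @` A))).
    by apply: belongs_same xA; exact: same_sym.
  by move=> /(star_belongs M _ _).2/belongs_individual[y Ay /iX_inj <-].
apply: (belongs_same _ _ _ _ E).
by apply: (star_belongs M _ _).1; apply/belongs_individual; exists x.
Qed.

Lemma star_set_nonempty (A : set X) : star_set iX M A !=set0 <-> A !=set0.
Proof.
split=> [/(star_elements_nonempty M _).2[_ /belongs_set_entity[_ [x Ax _] _]]|[x Ax]].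
  by exists x.
by exists (star_point iX M x); apply/star_pointP.
Qed.

Lemma star_setI (A B : set X) :
  star_set iX M (A `&` B) = star_set iX M A `&` star_set iX M B.
Proof.
apply/seteqP; split=> [a ABa|]; last first.
  apply: star_elements_setI => x.
  move=> [/belongs_set_entity[_ [a Aa <-] xa]].
  move=> /belongs_set_entity[_ [b Bb <-] xb].
  have ab : a = b.
    apply: iX_inj; apply: same_individual.
    by apply: same_trans xb; exact: same_sym.
  apply/belongs_set_entity; exists (iX a) => //.
  by exists a => //; split=> //; rewrite ab.
(* Intersecting the star of the intersection of A and B with itself reduces the transferred
   inclusion to monotonicity, once for each factor. *)
split; apply: (star_elements_setI M _ _ _ _ a (conj ABa ABa)) => x [];
  by move=> /belongs_set_entity[_ [c [Ac Bc] <-] xc] _;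
     apply/belongs_set_entity; exists (iX c) => //; exists c.
Qed.

Lemma star_set_subset (A B : set X) :
  A `<=` B -> star_set iX M A `<=` star_set iX M B.
Proof. by move=> /setIidPl <-; rewrite star_setI => a []. Qed.

Lemma monad_self (a : superstructure (star_individuals M)) :
  monad iX a a.
Proof. by move=> G []. Qed.

(** A point lies in its own monad, so comparing monads amounts to comparing the open sets whose
    stars contain the points. This is the specialization preorder for the topology generated by the
    sets *G with G open. *)
Lemma monad_leP (a b : superstructure (star_individuals M)) :
  monad_le iX a b <->
  forall G : set X, open G -> star_set iX M G b -> star_set iX M G a.
Proof.
split=> [ab G Go Gb|ab c ac G [Go Gb]]; first exact: (ab a (monad_self a)).
by apply: ac; split => //; exact: ab.
Qed.

(** Minimality of x in *A says that x lies in every open G whose star meets *A. By transfer these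
    are the G that meet A, so the condition says that every point of A is adherent to x. *)
Lemma least_pointP (A : set X) (x : X) : closed A ->
  (A x /\ forall a, star_set iX M A a -> monad_le iX (star_point iX M x) a)
  <-> A = closure [set x].
Proof.
move=> Acl; split=> [[Ax xmin]|->].
  apply/seteqP; split=> [a Aa B|]; last first.
    by rewrite [X in _ `<=` X](closure_id _).1 //; apply: closure_subset => _ ->.
  rewrite nbhsE => -[G [Go Ga] GB]; exists x; split => //; apply: GB.
  apply/star_pointP; have /star_pointP/xmin/monad_leP := Aa; apply=> //.
  exact/star_pointP.
split=> [|a xa]; first exact: subset_closure.
apply/monad_leP => G Go Ga; apply/star_pointP.
have [|y [xy Gy]] := (star_set_nonempty (closure [set x] `&` G)).1.
  by exists a; rewrite star_setI.
by have [z [->]] := xy G (open_nbhs_nbhs (conj Go Gy)).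
Qed.

(** Otherwise A would be the union of the closed sets A \ G and A \ H, hence equal to one of them,
    although both G and H meet A. *)
Lemma irreducible_openI (A G H : set X) : irreducible_closed A ->
  open G -> open H -> A `&` G !=set0 -> A `&` H !=set0 ->
  A `&` (G `&` H) !=set0.
Proof.
move=> [_ Acl irr] Go Ho [a [Aa Ga]] [b [Ab Hb]]; apply: contrapT => AGH.
have [|||E|E] := irr (A `\` G) (A `\` H).
- by apply: closedI => //; exact: open_closedC.
- by apply: closedI => //; exact: open_closedC.
- rewrite -setDIr; apply/seteqP; split=> [c Ac|c []//].
  by split=> // GHc; apply: AGH; exists c.
- by rewrite E in Aa; case: Aa.
by rewrite E in Ab; case: Ab.
Qed.

Lemma irreducible_open_bigcap (A : set X) (I : choiceType) (G : I -> set X)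
    (J : set I) : irreducible_closed A -> finite_set J ->
  (forall i, J i -> open (G i) /\ A `&` G i !=set0) ->
  A `&` \bigcap_(i in J) G i !=set0.
Proof.
move=> Airr /finite_seqP[s ->{J}]; rewrite bigcap_seq.
(* Openness of the partial intersections is carried through the induction, because
   [irreducible_openI] needs it; the empty intersection uses that A is nonempty. *)
suff h : (forall i, i \in s -> open (G i) /\ A `&` G i !=set0) ->
    open (\big[setI/setT]_(i <- s) G i) /\
    A `&` \big[setI/setT]_(i <- s) G i !=set0 by move=> /h[].
elim: s => [|i s IH] Gs.
  by rewrite big_nil setIT; split; [exact: openT | case: Airr].
have [Gio AGi] := Gs _ (mem_head i s).
have [|Gso AGs] := IH; first by move=> j js; apply: Gs; rewrite inE js orbT.
rewrite big_cons; split; first exact: openI.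
exact: irreducible_openI.
Qed.

Lemma irreducible_directed (A : set X) :
  [set G : set X | open G] #<= [set: K] ->
  irreducible_closed A -> downward_directed iX (star_set iX M A).
Proof.
move=> cardK Airr a b Aa Ab.
pose I := set_type [set G : set X | open G].
pose near G := star_set iX M G a \/ star_set iX M G b.
(* Indexing by all open sets keeps the family within the bound that saturation allows. Irrelevant
   indices get the whole space, whose star contains *A and which therefore imposes no condition
   inside *A. *)
pose G (i : I) : set X := if `[< near (val i) >] then val i else setT.
have Gnear i : near (G i).
  rewrite /G; case: asboolP => // _; left.
  by apply: (star_set_subset A) Aa.
have AG i : A `&` G i !=set0.
  by apply: (star_set_nonempty _).1; rewrite star_setI;
     case: (Gnear i) => ?; [exists a | exists b].
have Gopen i : open (G i).
  by rewrite /G; case: asboolP => _; [exact: set_valP | exact: openT].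
have [||J Jfin|c Fc] := @saturation _ _ M I
  (fun i => star M (set_entity (iX @` (A `&` G i)))).
- by rewrite (card_le_eql (card_setT _)).
- move=> i; split; last exact: star_internal.
  by have [x /belongs_is_set] := (star_set_nonempty _).2 (AG i).
(* Finite intersection property: the open sets [G i] with i in J have a common point in A, so the
   star of that intersection has an element, and by monotonicity it lies in each member of the
   subfamily. *)
- have [|x Jx] := (star_set_nonempty _).2
    (irreducible_open_bigcap A _ G J Airr Jfin _).
    by move=> i _; split; [exact: Gopen | exact: AG].
  exists x => i Ji; apply: star_set_subset Jx; apply: setIS.
  exact: bigcap_inf.
have Fc' H : open H -> near H -> star_set iX M (A `&` H) c.
  move=> Ho nH; have := Fc (SigSub (mem_set Ho)) Logic.I.
  by rewrite /G /=; case: asboolP.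
exists c; split.
(* The index [setT] yields membership of c in *A itself. *)
- have := Fc' setT openT; rewrite setIT; apply; left.
  exact: star_set_subset Aa.
- apply/monad_leP => H Ho Ha; have := Fc' H Ho (or_introl Ha).
  by rewrite star_setI => -[].
- apply/monad_leP => H Ho Hb; have := Fc' H Ho (or_intror Hb).
  by rewrite star_setI => -[].
Qed.

Lemma directed_irreducible (A : set X) : A !=set0 -> closed A ->
  downward_directed iX (star_set iX M A) -> irreducible_closed A.
Proof.
move=> A0 Acl Adir; split=> // F1 F2 F1cl F2cl AF.
apply: contrapT => /not_orP[AF1 AF2].
have [a [Aa F1a]] : A `\` F1 !=set0.
  apply/set0P/eqP; rewrite setD_eq0 => AsubF1; apply: AF1.
  by apply/seteqP; split=> // x F1x; rewrite AF; left.
have [b [Ab F2b]] : A `\` F2 !=set0.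
  apply/set0P/eqP; rewrite setD_eq0 => AsubF2; apply: AF2.
  by apply/seteqP; split=> // x F2x; rewrite AF; right.
have [|| c [Ac /monad_leP ca /monad_leP cb]] :=
  Adir (star_point iX M a) (star_point iX M b); try exact/star_pointP.
(* The lower bound c lies in the star of A minus both closed sets, so by transfer this difference
   has a standard point, against [AF]. *)
have [|x [Ax [F1x F2x]]] := (star_set_nonempty (A `&` (~` F1 `&` ~` F2))).1.
  exists c; rewrite !star_setI; split=> //; split.
    by apply: ca; [exact: closed_openC | exact/star_pointP].
  by apply: cb; [exact: closed_openC | exact/star_pointP].
by move: Ax; rewrite AF => -[].
Qed.

End StarSet.

Theorem mainTheorem9 (X : topologicalType) (R : realType)
    (S : Type) (iX : X -> S) (iR : R -> S)
    (iX_inj : injective iX) (iR_inj : injective iR)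
    (K : Type) (K_infinite : infinite_set [set: K])
    (K_ge : [set G : set X | open G] #<= [set: K])
    (K_gt : ~ ([set: K] #<= [set G : set X | open G]))
    (M : saturated_model S K) :
  sober X <->
  (forall A : set X, A !=set0 -> closed A ->
     downward_directed iX (star_set iX M A) ->
     exists2 x : X, A x &
       forall a, star_set iX M A a -> monad_le iX (star_point iX M x) a).
Proof.
split=> [Xsober A A0 Acl Adir|Xleast A Airr].
  have [x /(least_pointP iX_inj M _ _ Acl)[Ax xmin]] :=
    Xsober A (directed_irreducible iX_inj M _ A0 Acl Adir).
  by exists x.
have [A0 Acl _] := Airr.
have [x Ax xmin] := Xleast A A0 Acl (irreducible_directed iX_inj M _ K_ge Airr).
by exists x; apply/(least_pointP iX_inj M).
Qed.
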